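(* Under the standing assumptions, suppose in addition that $J$ is absolutely $p$-homogeneous and that $|u|_J:=(pJ(u))^{1/p}$ is a norm on $X$ such that $(X,|\cdot|_J)$ and $(X,|\cdot|_H)$ are reflexive Banach spaces, $(X,|\cdot|_J)$ is compactly embedded into $(X,|\cdot|_H)$, and $J$ is lower semi-continuous with respect to $|\cdot|_H$. Let $u^0\in X$ with $|u^0|_H=1$ and let $(u^k)$, $(u^{k+1/2})$, $(\zeta^k)$ be generated by the inverse power method $$\zeta^k\in\partial H(u^k),\qquad u^{k+1/2}\in\partial J^*(\zeta^k),\qquad u^{k+1}=\frac{u^{k+1/2}}{|u^{k+1/2}|_H}.$$ Then there is a subsequence $(u^{k_l})_{l\in\mathbb N}$ converging strongly with respect to both $|\cdot|_H$ and $|\cdot|_J$ to some $\bar u$, and $\bar u$ is a $p$-eigenvector of $J$ (with duality map $\partial H$), i.e. there is $\zeta\in\partial J(\bar u)$ with $\zeta\in R(\bar u)\,\partial H(\bar u)$.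
   Context: Standing assumptions: $X$ is a real reflexive Banach space with dual $X^*$ and duality pairing $\langle\cdot,\cdot\rangle$; $\Gamma_0(X)$ is the class of proper, lower semi-continuous, convex functionals $X\to\mathbb{R}\cup\{+\infty\}$. Fix $1<p<\infty$ and $q=\frac{p}{p-1}$. Let $J\in\Gamma_0(X)$, and let $H\in\Gamma_0(X)$ be absolutely $p$-homogeneous ($H(tu)=|t|^pH(u)$) such that $|u|_H:=(pH(u))^{1/p}$ is a norm on $X$, so $H(u)=\frac1p|u|_H^p$. The dual norm is $|\zeta|_{H^*}=\sup_{u\ne0}\langle\zeta,u\rangle/|u|_H$, and $H^*(\zeta)=\frac1q|\zeta|_{H^*}^q$. The Fenchel conjugate is $J^*(\zeta)=\sup_{u\in X}\langle\zeta,u\rangle-J(u)$ and the subdifferential is $\partial J(u)=\{\zeta\in X^*:\ J(u)+\langle\zeta,v-u\rangle\le J(v)\ \forall v\in X\}$. Growth assumption: there is $c>0$ with $H(u)\le cJ(u)$ for all $u\in X$. The Rayleigh quotient is $R(u)=J(u)/H(u)$ for $u\ne0$. A $p$-eigenvector of $J$: $u\in X\setminus\{0\}$ with subgradient $\zeta\in\partial J(u)$ and eigenvalue $\lambda=R(u)\in\mathbb{R}$ such that $\zeta\in\lambda\,\partial H(u)$. *)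

(* Defs.v *)
From HB Require Import structures.
From mathcomp Require Import all_boot all_order all_algebra.
From mathcomp Require Import all_classical all_reals all_analysis.
Set Implicit Arguments. Unset Strict Implicit. Unset Printing Implicit Defensive.
Import Order.TTheory GRing.Theory Num.Theory.
Local Open Scope ring_scope.
Local Open Scope classical_set_scope.

(* All notions are parametrized by a norm function N : X -> R on a real
   vector space X, so that the same space X can be considered with the
   ambient norm and with |.|_H, |.|_J. *)
Section Defs.
Variables (R : realType) (X : lmodType R).

Definition is_norm (N : X -> R) : Prop :=
  [/\ forall x, 0 <= N x,
      forall x, N x = 0 -> x = 0,
      forall (a : R) x, N (a *: x) = `|a| * N x &
      forall x y, N (x + y) <= N x + N y].

Definition banach (N : X -> R) : Prop :=
  is_norm N /\
  forall u : nat -> X,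
    (forall e : R, 0 < e -> exists n0 : nat,
        forall m n : nat, (n0 <= m)%N -> (n0 <= n)%N -> N (u m - u n) < e) ->
    exists l : X, N (u n - l) @[n --> \oo] --> 0.

Definition dual (N : X -> R) (f : X -> R) : Prop :=
  [/\ forall x y, f (x + y) = f x + f y,
      forall (a : R) x, f (a *: x) = a * f x &
      exists C : R, forall x, `|f x| <= C * N x].

Definition dual_norm (N : X -> R) (f : X -> R) : R :=
  sup [set `|f x| | x in [set x | N x <= 1]].

Definition bidual (N : X -> R) (phi : (X -> R) -> R) : Prop :=
  [/\ forall f g, dual N f -> dual N g -> phi (f \+ g) = phi f + phi g,
      forall (a : R) f, dual N f -> phi (fun x => a * f x) = a * phi f &
      exists C : R, forall f, dual N f -> `|phi f| <= C * dual_norm N f].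

Definition reflexive_banach (N : X -> R) : Prop :=
  banach N /\
  forall phi, bidual N phi -> exists x : X, forall f, dual N f -> phi f = f x.

Local Open Scope ereal_scope.

Definition proper_fun (F : X -> \bar R) : Prop :=
  (exists u, F u != +oo) /\ (forall u, F u != -oo).

Definition convex_fun (F : X -> \bar R) : Prop :=
  forall (t : R) (u v : X), (0 < t < 1)%R ->
    F (t *: u + (1 - t) *: v)%R <= t%:E * F u + (1 - t)%:E * F v.

Definition lsc (N : X -> R) (F : X -> \bar R) : Prop :=
  forall (u : X) (r : R), r%:E < F u ->
    exists2 d : R, (0 < d)%R & forall v, (N (v - u) < d)%R -> r%:E < F v.

Definition Gamma0 (N : X -> R) (F : X -> \bar R) : Prop :=
  [/\ proper_fun F, lsc N F & convex_fun F].

Definition abs_p_homogeneous (p : R) (F : X -> \bar R) : Prop :=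
  forall (t : R) (u : X), F (t *: u)%R = (`|t| `^ p)%:E * F u.

Definition subdiff (N : X -> R) (F : X -> \bar R) (u : X) (zeta : X -> R) : Prop :=
  dual N zeta /\ forall v, F u + (zeta (v - u)%R)%:E <= F v.

Definition conj_fun (F : X -> \bar R) (zeta : X -> R) : \bar R :=
  ereal_sup [set (zeta u)%:E - F u | u in [set: X]].

(* u in dF^*(zeta), where u in X is identified with its canonical image in
   the bidual (X reflexive) *)
Definition subdiff_conj (N : X -> R) (F : X -> \bar R) (zeta : X -> R) (u : X) : Prop :=
  forall eta, dual N eta -> conj_fun F zeta + (eta u - zeta u)%R%:E <= conj_fun F eta.

Definition compact_embedding (NJ NH : X -> R) : Prop :=
  (exists C : R, forall u, (NH u <= C * NJ u)%R) /\
  forall u : nat -> X, (exists M : R, forall n, (NJ (u n) <= M)%R) ->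
    exists (phi : nat -> nat) (l : X),
      {homo phi : m n / (m < n)%N >-> (m < n)%N} /\
      NH (u (phi n) - l)%R @[n --> \oo] --> 0%R.

(* p-eigenvector of J with duality map dH: u <> 0, lambda = R(u) = J(u)/H(u)
   is real, and there is zeta in dJ(u) with zeta in lambda dH(u) *)
Definition p_eigenvector (N : X -> R) (J H : X -> \bar R) (u : X) : Prop :=
  u <> 0%R /\
  exists (lambda h : R),
    [/\ H u = h%:E, h <> 0%R, J u = (lambda * h)%:E &
        exists zeta, subdiff N J u zeta /\
          exists eta, subdiff N H u eta /\ forall v, zeta v = (lambda * eta v)%R].

End Defs.

(* Main.v *)
Require Import Defs.
From HB Require Import structures.
From mathcomp Require Import all_boot all_order all_algebra.
From mathcomp Require Import all_classical all_reals all_analysis.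
From mathcomp Require Import ring lra.
Import Order.TTheory GRing.Theory Num.Theory.
Import numFieldNormedType.Exports.
Local Open Scope ring_scope.
Local Open Scope classical_set_scope.

(**
  [J] and [H] are finite and lower semi-continuous on Banach spaces, so a
  Baire-type argument bounds [NJ] and [NH] by [N0], and [NJ] by [NH].  Strong
  convergence in [NH], which compactness provides, thus gives convergence in [NJ].

  Along the iteration [m_k = NJ (u_k)] is nonincreasing with a limit [mu > 0],
  and with [s_k = NJ (uh_k) ^ (p - 1)] one has
  [zeta_k <= NH], [zeta_k <= s_k NJ], [zeta_k (u_(k+1)) = s_k m_(k+1)] and
  [s_k m_(k+1) <= 1 <= s_k m_k].  In the limit
  [1 <= NH (ubar - v) + NJ v / mu] for all [v], so Hahn-Banach applied to the
  infimal convolution of [NH] and [NJ / mu] yields a functional [f] below both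
  with [f ubar = 1]; then [f] is a subgradient of [H] at [ubar] and
  [mu ^ p f] one of [J].  No weak limit of the [zeta_k] is needed.
*)

(** * The Hahn-Banach theorem *)

Section HahnBanach.
Context {R : realType} {X : lmodType R}.

(** Homogeneity is asked only as an inequality, which is what infima give directly; rescaling by the
    inverse restores equality. *)
Definition sublinear (q : X -> R) : Prop :=
  (forall x y, q (x + y) <= q x + q y) /\
  (forall (a : R) x, 0 < a -> q (a *: x) <= a * q x).

Definition is_linear (f : X -> R) : Prop :=
  (forall x y, f (x + y) = f x + f y) /\
  (forall (a : R) x, f (a *: x) = a * f x).

Lemma sublinearZ {q : X -> R} (a : R) x :
  sublinear q -> 0 < a -> q (a *: x) = a * q x.
Proof.
move=> [_ qZ] a0; apply/eqP; rewrite eq_le qZ//=.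
rewrite -ler_pdivlMl// -{1}(scale1r x) -(mulVf (lt0r_neq0 a0)) -scalerA.
by apply: qZ; rewrite invr_gt0.
Qed.

Lemma sublinear0 {q : X -> R} : sublinear q -> q 0 = 0.
Proof.
move=> sq; by have := sublinearZ 2%:R 0 sq (ltr0n _ _); rewrite scaler0; lra.
Qed.

Lemma sublinear_ge_opp {q : X -> R} x : sublinear q -> - q (- x) <= q x.
Proof.
by move=> sq; have := sq.1 x (- x); rewrite subrr (sublinear0 sq); lra.
Qed.

Lemma is_linearB {f : X -> R} x y : is_linear f -> f (x - y) = f x - f y.
Proof. by move=> [fD fZ]; rewrite fD -scaleN1r fZ mulN1r. Qed.

(* [C] is a convex cone in [X * R] and the infimum is its lower envelope. *)
Lemma sublinear_inf (C : X -> set R) (b : X -> R) :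
  (forall x, C x !=set0) -> (forall x, lbound (C x) (b x)) ->
  (forall x y r s, C x r -> C y s -> C (x + y) (r + s)) ->
  (forall a x r, 0 < a -> C x r -> C (a *: x) (a * r)) ->
  sublinear (fun x => inf (C x)).
Proof.
move=> C0 Cb CD CZ.
have infC x r : C x r -> inf (C x) <= r by apply: ge_inf; exists (b x).
split=> [x y|a x a0].
  rewrite -lerBlDr; apply: lb_le_inf => // r Cr; rewrite lerBlDr -lerBlDl.
  apply: lb_le_inf => // s Cs; rewrite lerBlDl.
  by apply: infC; exact: CD.
rewrite -ler_pdivrMl//; apply: lb_le_inf => // r Cr.
by rewrite ler_pdivrMl//; apply: infC; exact: CZ.
Qed.

(** Upward closure makes these sets the fibres of a convex cone, so that [sublinear_inf] applies. *)
Definition dir_cone (q : X -> R) (y x : X) : set R :=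
  [set r | exists2 t, 0 <= t & q (x + t *: y) - t * q y <= r].

Definition dir_inf (q : X -> R) (y x : X) : R := inf (dir_cone q y x).

Lemma dir_cone_lb (q : X -> R) y x : sublinear q ->
  lbound (dir_cone q y x) (- q (- x)).
Proof.
move=> sq r [t t0]; apply: le_trans.
have := sq.1 (x + t *: y) (- x); rewrite addrAC subrr add0r.
suff -> : q (t *: y) = t * q y by lra.
move: t0; rewrite le_eqVlt => /predU1P[<-|t0]; last exact: sublinearZ.
by rewrite scale0r mul0r sublinear0.
Qed.

Lemma dir_inf_le (q : X -> R) y x t : sublinear q -> 0 <= t ->
  dir_inf q y x <= q (x + t *: y) - t * q y.
Proof.
move=> sq t0; apply: ge_inf; last by exists t.
by exists (- q (- x)); exact: dir_cone_lb.
Qed.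

Lemma sublinear_dir_inf (q : X -> R) y : sublinear q -> sublinear (dir_inf q y).
Proof.
move=> sq; apply: (sublinear_inf _ (fun x => - q (- x))).
- by move=> x; exists (q (x + 0 *: y) - 0 * q y); exists 0.
- by move=> x; exact: dir_cone_lb.
- move=> x1 x2 r1 r2 [s s0 h1] [t t0 h2]; exists (s + t); first exact: addr_ge0.
  have := sq.1 (x1 + s *: y) (x2 + t *: y).
  by rewrite addrACA -scalerDl mulrDl; lra.
- move=> a x r a0 [t t0 h]; exists (a * t); first by rewrite mulr_ge0// ltW.
  by rewrite -scalerA -scalerDr sublinearZ// -mulrA -mulrBr ler_pM2l.
Qed.

(** Taking t = 0 puts [dir_inf q y] below [q], so minimality makes them equal, and t = 1 then yields
    superadditivity. *)
Lemma minimal_sublinear_linear (q : X -> R) : sublinear q ->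
  (forall q', sublinear q' -> (forall x, q' x <= q x) -> q' = q) ->
  is_linear q.
Proof.
move=> sq qmin.
have qD x y : q (x + y) = q x + q y.
  apply/eqP; rewrite eq_le sq.1/=.
  have dE : dir_inf q y = q.
    apply: qmin; first exact: sublinear_dir_inf.
    move=> z; have := dir_inf_le q y z 0 sq (lexx _).
    by rewrite scale0r addr0 mul0r subr0.
  by have := dir_inf_le q y x 1 sq ler01; rewrite dE scale1r mul1r lerBrDr.
have qN x : q (- x) = - q x.
  by apply/eqP; rewrite -addr_eq0 -qD addNr sublinear0.
split=> // a x; have [a0|a0|->] := ltgtP a 0.
- by rewrite -(opprK (a *: x)) qN -scaleNr sublinearZ ?oppr_gt0// mulNr opprK.
- exact: sublinearZ.
- by rewrite scale0r mul0r sublinear0.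
Qed.

(* Chains of sublinear functionals below [q] have their pointwise infimum as a
   lower bound; a minimal one is linear since [dir_inf] cannot decrease it. *)
Lemma linear_minorant (q : X -> R) : sublinear q ->
  exists2 f, is_linear f & forall x, f x <= q x.
Proof.
move=> sq; pose P (g : X -> R) := sublinear g /\ forall x, g x <= q x.
pose T := {g | P g}.
(* The order is reversed, so that a maximal element for Zorn is a minimal functional. *)
pose le_T (g h : T) : bool := `[< forall x, sval h x <= sval g x >].
have T_ext (g h : T) : sval g = sval h -> g = h.
  by move: g h => [g pg] [h ph] /= gh; subst h; congr exist; exact: Prop_irrelevance.
have q0 : T by exists q; split.
have [||||[g [sg gq]] gmax] := @Zorn T le_T.
- by move=> g; apply/asboolP.
- move=> f g h /asboolP fg /asboolP gh; apply/asboolP => x.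
  exact: le_trans (gh x) (fg x).
- move=> g h /asboolP gh /asboolP hg; apply: T_ext; apply/funext => x.
  by apply/eqP; rewrite eq_le gh hg.
- move=> A totA; have [[a Aa]|A0] := pselect (exists a, A a); last first.
    by exists q0 => s As; case: A0; exists s.
  pose C x : set R := [set r | exists2 g, A g & sval g x <= r].
  have Clb x : lbound (C x) (- q (- x)).
    move=> r [g Ag]; apply: le_trans; have [sg gq] := svalP g.
    by rewrite (le_trans _ (sublinear_ge_opp x sg))// lerN2.
  have sC : sublinear (fun x => inf (C x)).
    apply: (sublinear_inf _ (fun x => - q (- x))) => //.
    + by move=> x; exists (sval a x); exists a.
    + move=> x y r s [g Ag gr] [h Ah hs].
      have [/asboolP gh|/asboolP hg] := totA _ _ Ag Ah.
      * exists h => //; have [[sh _] _] := svalP h.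
        by rewrite (le_trans (sh _ _))// lerD// (le_trans (gh x)).
      * exists g => //; have [[sg _] _] := svalP g.
        by rewrite (le_trans (sg _ _))// lerD// (le_trans (hg y)).
    + move=> b x r b0 [g Ag gr]; exists g => //; have [sg _] := svalP g.
      by rewrite sublinearZ// ler_pM2l.
  have Cle g x : A g -> inf (C x) <= sval g x.
    by move=> Ag; apply: ge_inf; [exists (- q (- x))|exists g].
  have Cq x : inf (C x) <= q x.
    by have [_ aq] := svalP a; exact: le_trans (Cle a x Aa) (aq x).
  by exists (exist P _ (conj sC Cq)) => s As; apply/asboolP => x; exact: Cle.
exists g => //; apply: minimal_sublinear_linear => // h sh hg.
have hq x : h x <= q x by exact: le_trans (hg x) (gq x).
have := gmax (exist P h (conj sh hq)).
have -> : le_T (exist P g (conj sg gq)) (exist P h (conj sh hq)) by apply/asboolP.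
by move=> /(_ isT) /(congr1 sval).
Qed.

(** A linear minorant of [dir_inf q x0] is at most [- q x0] at [- x0], which forces equality at
    [x0]. *)
Lemma hahn_banach_at (q : X -> R) (x0 : X) : sublinear q ->
  exists f, [/\ is_linear f, forall x, f x <= q x & f x0 = q x0].
Proof.
move=> sq; have [f lf fq] := linear_minorant _ (sublinear_dir_inf q x0 sq).
have fle x : f x <= q x.
  have := dir_inf_le q x0 x 0 sq (lexx _).
  by rewrite scale0r addr0 mul0r subr0; exact: le_trans.
exists f; split=> //; apply/eqP; rewrite eq_le fle/=.
have := le_trans (fq (- x0)) (dir_inf_le q x0 (- x0) 1 sq ler01).
rewrite scale1r addNr mul1r sublinear0// sub0r.
by rewrite -scaleN1r lf.2 mulN1r lerN2.
Qed.
End HahnBanach.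

(** * Lower semi-continuous norms on Banach spaces *)

Section Norms.
Context {R : realType} {X : lmodType R}.
Implicit Types M N : X -> R.

Lemma is_norm0 {N} : is_norm N -> N 0 = 0.
Proof. by move=> [_ _ NZ _]; rewrite -(scale0r 0) NZ normr0 mul0r. Qed.

Lemma is_normN {N} x : is_norm N -> N (- x) = N x.
Proof. by move=> [_ _ NZ _]; rewrite -scaleN1r NZ normrN1 mul1r. Qed.

Lemma is_norm_distC {N} x y : is_norm N -> N (x - y) = N (y - x).
Proof. by move=> nN; rewrite -(is_normN _ nN) opprB. Qed.

Lemma is_norm_gt0 {N} x : is_norm N -> x <> 0 -> 0 < N x.
Proof.
by move=> [N0 Nx _ _] x0; rewrite lt_neqAle N0 andbT eq_sym; apply/eqP => /Nx.
Qed.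

Lemma is_norm_sublinear {N} : is_norm N -> sublinear N.
Proof. by move=> [_ _ NZ ND]; split=> // a x a0; rewrite NZ gtr0_norm. Qed.

Lemma is_norm_leB {N} x y : is_norm N -> N x - N y <= N (x - y).
Proof. by move=> [_ _ _ ND]; rewrite lerBlDr -{1}(subrK y x). Qed.

Lemma is_norm_cvg {N} (x : nat -> X) l : is_norm N ->
  N (x n - l) @[n --> \oo] --> 0 -> N (x n) @[n --> \oo] --> N l.
Proof.
move=> nN /cvgrPdist_lt xl; apply/cvgrPdist_lt => e e0; near=> n.
have : `|0 - N (x n - l)| < e by near: n; exact: xl.
rewrite sub0r normrN; apply: le_lt_trans; rewrite (le_trans _ (ler_norm _))//.
rewrite ler_norml lerNl opprB is_norm_leB//=.
by rewrite (is_norm_distC _ _ nN) is_norm_leB.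
Unshelve. all: by end_near. Qed.

Lemma lin_dominated_dual {N M} f (C K : R) : is_norm M -> is_linear f ->
  (forall x, f x <= K * M x) -> 0 <= K -> (forall x, M x <= C * N x) -> dual N f.
Proof.
move=> nM [fD fZ] fK K0 MC; split=> //; exists (K * C) => x.
rewrite -mulrA; apply: (@le_trans _ _ (K * M x)); last exact: ler_wpM2l.
by rewrite ler_norml fK andbT lerNl -mulN1r -fZ scaleN1r -(is_normN x nM) fK.
Qed.

(* Otherwise gliding-hump balls [B(x_n, r_n)] can be nested with [M > n] on the
   n-th one, which is absurd at their common point. *)
Lemma lsc_norm_dominated N M : banach N -> is_norm M ->
  (forall x (r : R), r < M x ->
    exists2 d : R, 0 < d & forall y, N (y - x) < d -> r < M y) ->
  exists C : R, forall x, M x <= C * N x.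
Proof.
move=> [nN cN] nM lM; have [Nge0 Neq0 NZ ND] := nN; have [Mge0 Meq0 MZ MD] := nM.
apply: contrapT => nC.
have hump (C : R) : exists x, C * N x < M x.
  apply: contrapT => hC; apply: nC; exists C => x; rewrite leNgt; apply/negP => h.
  by apply: hC; exists x.
(* Pairs are centres and radii of closed balls; the guard [0 < z.2] lets every pair have a
   successor, so that [choice] applies. *)
pose good (n : nat) (z z' : X * R) := 0 < z.2 ->
  [/\ 0 < z'.2, z'.2 <= n.+1%:R^-1 &
    forall y, N (y - z'.1) <= z'.2 -> N (y - z.1) <= z.2 /\ n%:R < M y].
have step (nz : nat * (X * R)) : exists z', good nz.1 nz.2 z'.
  move: nz => [n [x d]]; rewrite /good/=; have [d0|d0] := ltP 0 d; last first.
    by exists (0, 0).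
  have Mx0 : 0 <= M x := Mge0 x.
  (* With this factor, [v] rescaled to [N]-norm d / 2 has [M]-norm above n + M x, so that M (x + w)
     > n. *)
  have [v] := hump (2 * (n%:R + M x) / d); move=> hv.
  have v0 : 0 < N v.
    apply: is_norm_gt0 => // v0; move: hv.
    by rewrite v0 (is_norm0 nM) (is_norm0 nN) mulr0 ltxx.
  pose w := (d / 2 / N v) *: v.
  have c0 : 0 < d / 2 / N v by rewrite !divr_gt0.
  have Nw : N w = d / 2 by rewrite NZ gtr0_norm// divfK// gt_eqF.
  have Mw : n%:R + M x < M w.
    rewrite MZ gtr0_norm// -ltr_pdivrMl//.
    suff <- : 2 * (n%:R + M x) / d * N v = (d / 2 / N v)^-1 * (n%:R + M x) by [].
    by field; rewrite !gt_eqF.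
  have [|e0 e0_gt0 he0] := lM (x + w) n%:R.
    have := MD (x + w) (- x); rewrite addrAC subrr add0r (is_normN _ nM).
    by move: Mw; lra.
  (* The first radius stays in the neighbourhood given by semi-continuity, the second in the old
     ball since N w = d / 2, and the third makes the centres Cauchy. *)
  exists (x + w, Num.min (e0 / 2) (Num.min (d / 2) n.+1%:R^-1)) => _ /=.
  split; first by rewrite !lt_min !divr_gt0//= invr_gt0.
    by rewrite !ge_min lexx !orbT.
  move=> y; rewrite !le_min => /and3P[y1 y2 y3]; split.
    have := ND (y - (x + w)) w; rewrite Nw opprD addrA subrK.
    by move: y2; rewrite opprD addrA; lra.
  by apply: he0; rewrite (le_lt_trans y1)//; move: e0_gt0; lra.
have [f fP] := choice step.
pose z := fix z n := if n is m.+1 then f (m, z m) else ((0, 1) : X * R).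
have z_gt0 n : 0 < (z n).2.
  by elim: n => [|n IH] /=; [exact: ltr01|have [] := fP (n, z n) IH].
have nest n m y : (n <= m)%N -> N (y - (z m).1) <= (z m).2 ->
    N (y - (z n).1) <= (z n).2.
  move=> /subnK <-; elim: (m - n)%N => // k IH; rewrite addSn => h.
  by apply: IH; have [_ _ /(_ y h)[]] := fP ((k + n)%N, z (k + n)%N) (z_gt0 _).
have dist n m : (n.+1 <= m)%N -> N ((z m).1 - (z n.+1).1) <= n.+1%:R^-1.
  move=> nm; have [_ h _] := fP (n, z n) (z_gt0 n); apply: le_trans h.
  by apply: (nest _ _ _ nm); rewrite subrr (is_norm0 nN) ltW.
have [l zl] : exists l, N ((z n).1 - l) @[n --> \oo] --> 0.
  apply: cN => e e0.
  have [n ne] : exists n : nat, n.+1%:R^-1 < e / 2.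
    have e20 : 0 < e / 2 by rewrite divr_gt0.
    by have [n] := ltr_add_invr e20; rewrite add0r; exists n.
  exists n.+1 => m k nm nk.
  have := ND ((z m).1 - (z n.+1).1) ((z n.+1).1 - (z k).1).
  rewrite addrA subrK (is_norm_distC (z n.+1).1 _ nN).
  move: ne (dist _ _ nm) (dist _ _ nk); move: (_^-1) => r; lra.
have lz n : N (l - (z n).1) <= (z n).2.
  apply/ler_addgt0Pr => e e0.
  move/cvgrPdist_lt : zl => /(_ _ e0)[k _ hk].
  have /hk /= := leq_maxr n k; rewrite sub0r normrN => h.
  have : N ((z (maxn n k)).1 - (z n).1) <= (z n).2.
    by apply: (nest _ _ _ (leq_maxl n k)); rewrite subrr (is_norm0 nN) ltW.
  have := ND (l - (z (maxn n k)).1) ((z (maxn n k)).1 - (z n).1).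
  rewrite addrA subrK (is_norm_distC l _ nN).
  by have := le_lt_trans (ler_norm _) h; lra.
have [n ln] : exists n : nat, M l < n%:R.
  by exists (Num.truncn (M l)).+1; rewrite truncnS_gt.
have [_ _ /(_ l (lz n.+1))[_]] := fP (n, z n) (z_gt0 n).
by move=> /(lt_trans ln); rewrite ltxx.
Qed.
End Norms.

(** * Subgradients of powers of norms *)

Section PowerSubgradient.
Context {R : realType}.
Implicit Types a b p t : R.

(** Young's inequality with exponents p / (p - 1) and p; rearranged, it is the gradient inequality
    of t ^ p / p at [a]. *)
Lemma powR_young a b p : 1 < p -> 0 <= a -> 0 <= b ->
  a `^ (p - 1) * b <= a `^ p - a `^ p / p + b `^ p / p.
Proof.
move=> p1 a0 b0; have p0 : 0 < p by rewrite (lt_trans _ p1).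
have pN0 : p != 0 by rewrite gt_eqF.
have p10 : p - 1 != 0 by rewrite subr_eq0 gt_eqF.
have := @conjugate_powR R (a `^ (p - 1)) b (p / (p - 1)) p (powR_ge0 _ _) b0.
rewrite -powRrM [(p - 1) * _]mulrC divfK// => /(_ _ _ _)/wrap[].
- by rewrite divr_gt0// subr_gt0.
- by [].
- by field; rewrite pN0 p10.
move=> h; apply: (le_trans h); rewrite lerD2r le_eqVlt; apply/orP; left; apply/eqP.
by field; rewrite pN0 p10.
Qed.

Lemma powRB1K t p : 1 < p -> 0 <= t -> (t `^ (p - 1)^-1) `^ (p - 1) = t.
Proof.
move=> p1 t0; rewrite -powRrM mulVf ?powRr1//.
by rewrite subr_eq0 gt_eqF.
Qed.

(* A line supporting [t ^ p / p] at [t = 1] has slope 1, by the gradient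
   inequality at the points [t] with [t ^ (p - 1) = 1 + d]. *)
Lemma powR_tangent_slope p a b : 1 < p -> 0 < b ->
  (forall t, 0 < t -> (t - 1) * a <= (t `^ p - 1) / p * b) -> a = b.
Proof.
move=> p1 b0 h.
have p0 : 0 < p by rewrite (lt_trans _ p1).
have p10 : 0 < p - 1 by rewrite subr_gt0.
have key (d : R) : 0 < d -> (d `^ (p - 1)^-1 - 1) * (a - d * b) <= 0.
  move=> d0; set t := d `^ _; have t0 : 0 < t by exact: powR_gt0.
  have := powR_young t 1 p p1 (ltW t0) ler01.
  rewrite powR1 mulr1 (powRB1K _ _ p1 (ltW d0)) => y1.
  have tp : t `^ p = t * d.
    by rewrite -(mulr_powRB1 (ltW t0) p0) (powRB1K _ _ p1 (ltW d0)).
  have : (t `^ p - 1) / p <= (t - 1) * d.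
    rewrite mulrBl; move: y1; rewrite mulrBl mul1r tp; lra.
  move=> /(ler_wpM2r (ltW b0)); have := h t t0; rewrite mulrBr mulrA; lra.
have up (d : R) : 1 < d -> a <= d * b.
  move=> d1; have d0 : 0 < d by rewrite (lt_trans _ d1).
  have := key d d0; rewrite pmulr_rle0 ?subr_le0// subr_gt0.
  have := @gt0_ltr_powR R (p - 1)^-1; rewrite invr_gt0 => /(_ p10 1 d).
  by rewrite powR1; apply=> //; rewrite nnegrE ltW.
have dn (d : R) : 0 < d -> d < 1 -> d * b <= a.
  move=> d0 d1; have := key d d0; rewrite nmulr_rle0 ?subr_ge0// subr_lt0.
  have := @gt0_ltr_powR R (p - 1)^-1; rewrite invr_gt0 => /(_ p10 d 1).
  by rewrite powR1; apply=> //; rewrite nnegrE ltW.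
apply/eqP; rewrite eq_le; apply/andP; split; apply/ler_addgt0Pr => e e0.
  have := up (1 + e / b); rewrite ltrDl divr_gt0// => /(_ isT).
  by rewrite mulrDl mul1r divfK// gt_eqF.
(* The value 1 - e / b is positive only if e < b; otherwise 1 / 2 already gives a > 0, hence b <= a
   + e. *)
have [eb|be] := ltP e b.
  have := dn (1 - e / b); rewrite subr_gt0 ltr_pdivrMr// mul1r => /(_ eb).
  rewrite ltrBlDr ltrDl divr_gt0// => /(_ isT).
  by rewrite mulrBl mul1r divfK ?gt_eqF//; lra.
by have : 2^-1 * b <= a by [apply: dn; lra]; lra.
Qed.

Context {X : lmodType R}.
Implicit Types (M N : X -> R) (f : X -> R).

Definition pow_subgradient M p w f :=
  forall v, M w `^ p / p + f (v - w) <= M v `^ p / p.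

(** Testing along the ray of [w] pins down [f w] by [powR_tangent_slope]; testing at multiples of
    [v] of norm M w gives the bound. The converse is [powR_young]. *)
Lemma pow_subgradientP M p w f : is_norm M -> 1 < p -> is_linear f ->
  pow_subgradient M p w f <->
  f w = M w `^ p /\ forall v, f v <= M w `^ (p - 1) * M v.
Proof.
move=> nM p1 lf; have [M0 M0eq MZ _] := nM; have [fD fZ] := lf.
have p0 : 0 < p by rewrite (lt_trans _ p1).
have pN0 : p != 0 by rewrite gt_eqF.
have f0 : f 0 = 0 by rewrite -(scale0r 0) fZ mul0r.
split=> [sf|[fw fM] v]; last first.
  rewrite is_linearB// fw; have := powR_young (M w) (M v) p p1 (M0 _) (M0 _).
  by have := fM v; lra.
have fwE : f w = M w `^ p.
  have [->|w0] := eqVneq w 0.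
    by rewrite f0 (is_norm0 nM) powR0.
  have Mw : 0 < M w by apply: is_norm_gt0 => //; exact/eqP.
  apply: (powR_tangent_slope p) => //; first exact: powR_gt0.
  move=> t t0; have := sf (t *: w).
  rewrite is_linearB// fZ MZ gtr0_norm// powRM ?(ltW t0)//.
  have -> : (t `^ p - 1) / p * M w `^ p = t `^ p * M w `^ p / p - M w `^ p / p by ring.
  by rewrite mulrBl mul1r; lra.
split=> // v; have [->|/eqP v0] := eqVneq v 0.
  by rewrite f0 mulr_ge0// powR_ge0.
have Mv : 0 < M v by exact: is_norm_gt0.
have key a : 0 < a -> a / M v * f v <= M w `^ p - M w `^ p / p + a `^ p / p.
  move=> a0; have := sf ((a / M v) *: v).
  have av0 : 0 < a / M v by rewrite divr_gt0.
  rewrite is_linearB// fZ MZ gtr0_norm// divfK ?gt_eqF// fwE; lra.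
have [Mw|Mw] := ltP 0 (M w).
  have := key (M w) Mw; rewrite subrK -(mulr_powRB1 (ltW Mw) p0) -mulrA.
  by rewrite ler_pM2l// ler_pdivrMl// mulrC.
have -> : M w = 0 by apply/eqP; rewrite eq_le Mw M0.
rewrite powR0 ?mul0r ?subr_eq0 ?gt_eqF//; apply/ler_addgt0Pr => e e0; rewrite add0r.
have eM : 0 < e / M v by rewrite divr_gt0.
(* Here M w = 0, and this small norm [a] satisfies a ^ (p - 1) = e / M v, so that [key] reduces to f
   v <= e / p. *)
have a0 : 0 < (e / M v) `^ (p - 1)^-1 by exact: powR_gt0.
have := key _ a0; have -> : M w = 0 by apply/eqP; rewrite eq_le Mw M0.
rewrite powR0// mul0r subrr add0r -(mulr_powRB1 (ltW a0) p0).
rewrite powRB1K ?(ltW eM)// -mulrA -[leRHS]mulrA ler_pM2l//.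
rewrite mulrC ler_pdivrMr// mulrAC divfK ?gt_eqF// => /le_trans; apply.
by rewrite ler_pdivrMr// ler_peMr// ltW.
Qed.
End PowerSubgradient.

(** * Subdifferentials of powers of norms and of their conjugates *)

Section Duality.
Context {R : realType} {X : lmodType R}.
Implicit Types (M N : X -> R) (f : X -> R).

Definition pow_fun M (p : R) : X -> \bar R := fun v => (M v `^ p / p)%:E.

(** Since t ^ p / p is strictly increasing for t >= 0, semi-continuity passes from the power to the
    norm. *)
Lemma lsc_pow_dominated N M p : banach N -> is_norm M -> 0 < p ->
  lsc N (pow_fun M p) -> exists C : R, forall x, M x <= C * N x.
Proof.
move=> bN nM p0 lM; apply: lsc_norm_dominated => // x r rM.
have [M0 _ _ _] := nM.
have [r0|r0] := ltP r 0.
  by exists 1 => // y _; exact: lt_le_trans r0 (M0 y).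
have mono (s : R) : 0 <= s -> (r < s) = ((r `^ p / p)%:E < (s `^ p / p)%:E)%E.
  move=> s0; rewrite lte_fin ltr_pM2r ?invr_gt0//.
  apply/idP/idP => [rs|]; first by apply: gt0_ltr_powR.
  by apply: contraTT; rewrite -!leNgt => sr; apply: ge0_ler_powR => //; exact: ltW.
have [|d d0 hd] := lM x (r `^ p / p); first by rewrite -mono.
by exists d => // y /hd; rewrite -mono.
Qed.

Lemma dual_linear N f : dual N f -> is_linear f.
Proof. by case. Qed.

Lemma subdiff_pow N M p w f : is_norm M -> 1 < p ->
  subdiff N (pow_fun M p) w f <->
  [/\ dual N f, f w = M w `^ p & forall v, f v <= M w `^ (p - 1) * M v].
Proof.
move=> nM p1; split=> [[df sf]|[df fw fM]].
  have /(pow_subgradientP _ _ _ _ nM p1 (dual_linear _ _ df))[] :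
    pow_subgradient M p w f by move=> v; have := sf v; rewrite lee_fin.
  by [].
split=> // v; rewrite lee_fin.
by have /(pow_subgradientP _ _ _ _ nM p1 (dual_linear _ _ df)) : 
  f w = M w `^ p /\ forall v, f v <= M w `^ (p - 1) * M v by [].
Qed.

(* Testing the conjugate inequality at a Hahn-Banach subgradient of the
   functional at [w] replaces the Fenchel-Moreau theorem. *)
Lemma subdiff_conj_pow N M p w f C : is_norm M -> 1 < p ->
  (forall x, M x <= C * N x) -> dual N f ->
  subdiff_conj N (pow_fun M p) f w -> subdiff N (pow_fun M p) w f.
Proof.
move=> nM p1 MC df sf; split=> // v.
have [g [lg gM gw]] := hahn_banach_at M w (is_norm_sublinear nM).
pose e x := M w `^ (p - 1) * g x.
have le_ : is_linear e.
  by split=> [x y|a x]; rewrite /e ?lg.1 ?lg.2 ?mulrDr// mulrCA.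
have eM x : e x <= M w `^ (p - 1) * M x by rewrite ler_wpM2l// powR_ge0.
have de : dual N e by apply: (lin_dominated_dual e C _ nM) eM _ MC => //; exact: powR_ge0.
have ew : e w = M w `^ p.
  have [M0 _ _ _] := nM.
  by rewrite /e gw mulrC mulr_powRB1// (lt_trans _ p1).
have /(subdiff_pow N M p w e nM p1)[_ se] :
  [/\ dual N e, e w = M w `^ p & forall v, e v <= M w `^ (p - 1) * M v] by [].
(* As [e] is a subgradient at [w], its conjugate is attained there; combined with [cf], the terms in
   [e w] cancel and leave the inequality for [f]. *)
have ce : (conj_fun (pow_fun M p) e <= (e w - M w `^ p / p)%:E)%E.
  apply: ge_ereal_sup => _ [x _ <-]; rewrite /pow_fun -EFinB lee_fin.
  by have := se x; rewrite /pow_fun lee_fin is_linearB//; lra.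
have cf : ((f v - M v `^ p / p)%:E <= conj_fun (pow_fun M p) f)%E.
  by apply: ereal_sup_ubound; exists v.
have := le_trans (le_trans (leeD2r (e w - f w)%:E cf) (sf e de)) ce.
rewrite -EFinD lee_fin lee_fin (is_linearB v w (dual_linear _ _ df)); lra.
Qed.
End Duality.

(** * Functionals dominated by two norms at once *)

Section InverseIteration.
Context {R : realType} {X : lmodType R}.
Implicit Types (M N : X -> R) (f : X -> R).

(* [f] is a minorant of the infimal convolution of [M] and [c N]. *)
Lemma linear_minorant_two_norms M N (w : X) (c : R) : is_norm M -> is_norm N -> 0 < c ->
  (forall v, 1 <= M (w - v) + c * N v) ->
  exists f, [/\ is_linear f, forall v, f v <= M v, forall v, f v <= c * N v & 1 <= f w].
Proof.
move=> nM nN c0 hw; have [M0 _ MZ MD] := nM; have [N0 _ NZ ND] := nN.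
pose D x : set R := [set r | exists v, M (x - v) + c * N v <= r].
have Dlb x : lbound (D x) 0.
  by move=> r [v]; apply: le_trans; rewrite addr_ge0// mulr_ge0// ltW.
have sD : sublinear (fun x => inf (D x)).
  apply: (sublinear_inf _ (fun=> 0)) => //.
  - by move=> x; exists (M (x - 0) + c * N 0); exists 0.
  - move=> x y r s [v vr] [v' vs]; exists (v + v').
    have := MD (x - v) (y - v'); rewrite addrACA -opprD.
    have := ler_wpM2l (ltW c0) (ND v v'); rewrite mulrDr; lra.
  - move=> a x r a0 [v vr]; exists (a *: v).
    rewrite -scalerBr MZ NZ gtr0_norm// mulrCA -mulrDr.
    by rewrite ler_pM2l.
have Dle x v : inf (D x) <= M (x - v) + c * N v.
  by apply: ge_inf; [exists 0|exists v].
have [f [lf fD fw]] := hahn_banach_at _ w sD.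
(* The trivial splittings v = v + 0 and v = 0 + v give the two bounds. *)
exists f; split=> // [v|v|].
- apply: le_trans (fD v) _.
  by rewrite (le_trans (Dle v 0))// subr0 (is_norm0 nN) mulr0 addr0.
- by apply: le_trans (fD v) _; rewrite (le_trans (Dle v v))// subrr (is_norm0 nM) add0r.
- rewrite fw; apply: lb_le_inf; first by exists (M (w - 0) + c * N 0); exists 0.
  by move=> r [v]; apply: le_trans.
Qed.

End InverseIteration.

(** * Convergence of the inverse power method *)

Theorem theorem3p2 (R : realType) (X : lmodType R) (N0 : X -> R)
  (J H : X -> \bar R) (p c : R) (NJ NH : X -> R)
  (u uh : nat -> X) (zeta : nat -> X -> R) :
  (* standing assumptions *)
  reflexive_banach N0 -> 1 < p ->
  Gamma0 N0 J -> Gamma0 N0 H ->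
  abs_p_homogeneous p H -> is_norm NH ->
  (forall v, H v = ((NH v `^ p) / p)%:E) ->
  0 < c -> (forall v, (H v <= c%:E * J v)%E) ->
  (* additional assumptions *)
  abs_p_homogeneous p J -> is_norm NJ ->
  (forall v, J v = ((NJ v `^ p) / p)%:E) ->
  reflexive_banach NJ -> reflexive_banach NH ->
  compact_embedding NJ NH -> lsc NH J ->
  (* inverse power method *)
  NH (u 0%N) = 1 ->
  (forall k, subdiff N0 H (u k) (zeta k)) ->
  (forall k, subdiff_conj N0 J (zeta k) (uh k)) ->
  (forall k, u k.+1 = (NH (uh k))^-1 *: uh k) ->
  exists (phi : nat -> nat) (ubar : X),
    [/\ {homo phi : m n / (m < n)%N >-> (m < n)%N},
        NH (u (phi l) - ubar) @[l --> \oo] --> 0,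
        NJ (u (phi l) - ubar) @[l --> \oo] --> 0 &
        p_eigenvector N0 J H ubar].
Proof.
move=> [bN0 _] p1 [_ lJ0 _] [_ lH0 _] _ nH HE _ _ _ nJ JE _ [bH _].
move=> [[CJ HJ] cpt] lJH u0 zH zJ uS.
have {}HE : H = pow_fun NH p by apply/funext.
have {}JE : J = pow_fun NJ p by apply/funext.
subst H J.
have p0 : 0 < p by rewrite (lt_trans _ p1).
have [H_ge0 H_eq0 HZ HD] := nH; have [J_ge0 J_eq0 JZ JD] := nJ.
have [CH0 H_le0] := lsc_pow_dominated _ _ _ bN0 nH p0 lH0.
have [CJ0 J_le0] := lsc_pow_dominated _ _ _ bN0 nJ p0 lJ0.
have [CJH J_leH] := lsc_pow_dominated _ _ _ bH nJ p0 lJH.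
have zJ' k : subdiff N0 (pow_fun NJ p) (uh k) (zeta k).
  by have [dz _] := zH k; exact: subdiff_conj_pow J_le0 dz (zJ k).
have linz k : is_linear (zeta k) by have [/dual_linear] := zH k.
pose s k := NJ (uh k) `^ (p - 1).
have zJs k v : zeta k v <= s k * NJ v.
  by have /(subdiff_pow _ _ _ _ _ nJ p1)[_ _] := zJ' k; exact.
have zHu k : NH (u k) = 1 -> zeta k (u k) = 1 /\ forall v, zeta k v <= NH v.
  move=> uk; have /(subdiff_pow _ _ _ _ _ nH p1)[_ zu zv] := zH k.
  by split=> [|v]; [rewrite zu uk powR1|rewrite (le_trans (zv v))// uk powR1 mul1r].
have uh_neq0 k : NH (u k) = 1 -> uh k <> 0.
  move=> uk uh0; have [zu _] := zHu k uk; have := zJs k (u k).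
  (* The exponent p - 1 must be nonzero, as 0 to the power 0 is 1. *)
  rewrite /s uh0 (is_norm0 nJ) powR0 ?subr_eq0 ?gt_eqF// mul0r zu.
  by rewrite ler10.
have uE k : NH (u k) = 1.
  elim: k => // k IH; rewrite uS HZ ger0_norm ?invr_ge0// mulVf//.
  by rewrite gt_eqF// is_norm_gt0//; exact: uh_neq0.
have H_gt0 k : 0 < NH (uh k) by apply: is_norm_gt0 => //; exact: uh_neq0.
have J_gt0 k : 0 < NJ (uh k) by apply: is_norm_gt0 => //; exact: uh_neq0.
pose m k := NJ (u k).
have u_neq0 k : u k <> 0.
  by move=> uk0; have := uE k; rewrite uk0 (is_norm0 nH) => /esym/eqP; rewrite oner_eq0.
have m_gt0 k : 0 < m k by apply: is_norm_gt0.
have s_gt0 k : 0 < s k by exact: powR_gt0.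
have sm_ge1 k : 1 <= s k * m k.
  by have [zu _] := zHu k (uE k); rewrite -zu; exact: zJs.
have zS k : zeta k (u k.+1) = s k * m k.+1.
  have /(subdiff_pow _ _ _ _ _ nJ p1)[_ zu _] := zJ' k.
  rewrite /m /s uS (linz k).2 zu JZ gtr0_norm ?invr_gt0//.
  by rewrite mulrCA [_ * NJ _]mulrC mulr_powRB1// ltW.
have sm_le1 k : s k * m k.+1 <= 1.
  by rewrite -zS -(uE k.+1); have [_] := zHu k (uE k); exact.
have m_dec k : m k.+1 <= m k.
  by rewrite -(ler_pM2l (s_gt0 k)); exact: le_trans (sm_le1 k) (sm_ge1 k).
have CJ_gt0 : 0 < CJ.
  by rewrite -(pmulr_lgt0 _ (m_gt0 0%N)) (lt_le_trans ltr01)// -u0; exact: HJ.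
(* The embedding constant keeps [m] away from 0 on the unit sphere of [NH], whence mu > 0. *)
have mJ k : CJ^-1 <= m k.
  by rewrite -(mulr1 CJ^-1) ler_pdivrMl// -(uE k); exact: HJ.
have m_noninc : nonincreasing_seq m by apply/nonincreasing_seqP.
have m_lb : has_lbound (range m) by exists CJ^-1 => _ [k _ <-].
have cvm := nonincreasing_cvgn m_noninc m_lb.
set mu := inf (range m) in cvm.
have mu_gt0 : 0 < mu.
  apply: (@lt_le_trans _ _ CJ^-1); first by rewrite invr_gt0.
  by apply: lb_le_inf => [|_ [k _ <-]]; [exists (m 0%N); exists 0%N|].
have mu_le k : mu <= m k by apply: ge_inf => //; exists k.
(* Compactness is applied to the shifted sequence so that every selected iterate has a predecessor
   [psi l], whose functional is tested on it below. *)
have [|psi [ubar [psi_mono cvH]]] := cpt (fun k => u k.+1).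
  by exists (m 0%N) => k; exact: m_noninc.
pose phi k := (psi k).+1.
have phi_mono : {homo phi : i j / (i < j)%N >-> (i < j)%N}.
  by move=> i j ij; rewrite /phi ltnS psi_mono.
have cvJ : NJ (u (phi l) - ubar) @[l --> \oo] --> 0.
  apply: (@squeeze_cvgr _ _ _ _ (fun=> 0) (fun l => CJH * NH (u (phi l) - ubar))).
  - by near=> l; rewrite J_ge0 J_leH.
  - exact: cvg_cst.
  - by rewrite -[X in _ --> X](mulr0 CJH); apply: cvgM => //; exact: cvg_cst.
have psi_ge k : (k <= psi k)%N.
  by elim: k => // k IH; rewrite (leq_ltn_trans IH)// psi_mono.
have Hbar : NH ubar = 1.
  have := is_norm_cvg _ _ nH cvH; under eq_fun do rewrite uE.
  by move=> /(cvg_unique (@Rhausdorff R) (cvg_cst _)) <-.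
have cvm_sub (chi : nat -> nat) : (forall k, (k <= chi k)%N) ->
    m (chi l) @[l --> \oo] --> mu.
  move=> chi_ge; apply/cvgrPdist_lt => e e0.
  move/cvgrPdist_lt : cvm => /(_ _ e0)[n _ hn]; exists n => // l /= nl.
  by apply: hn => /=; exact: leq_trans nl (chi_ge l).
have cvmpsi := cvm_sub _ psi_ge.
have cvmphi := cvm_sub phi (fun k => leqW (psi_ge k)).
have Jbar : NJ ubar = mu.
  by have := is_norm_cvg _ _ nJ cvJ => /(cvg_unique (@Rhausdorff R) cvmphi) <-.
have [f [lf fH fJ f1]] : exists f, [/\ is_linear f, forall v, f v <= NH v,
    forall v, f v <= mu^-1 * NJ v & 1 <= f ubar].
  apply: linear_minorant_two_norms => //; first by rewrite invr_gt0.
  move=> v.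
  (* Split u_(k+1) as (ubar - v) + v + (u_(k+1) - ubar) and apply zeta_k: the bound by [NH] serves
     the outer terms, the bound by s_k NJ with s_k <= 1 / mu the middle one. From below, s_k m_(k+1)
     >= m_(k+1) / m_k >= mu / m_k. *)
  have key l : mu / m (psi l) <= NH (ubar - v) + mu^-1 * NJ v + NH (u (phi l) - ubar).
    rewrite /phi; set k := psi l.
    have [_ zv] := zHu k (uE k).
    have lo : mu / m k <= zeta k (u k.+1).
      rewrite zS ler_pdivrMr// mulrAC (le_trans (mu_le k.+1))//.
      by rewrite -{1}(mul1r (m _)) ler_wpM2r// ltW.
    have hi : zeta k v <= mu^-1 * NJ v.
      rewrite (le_trans (zJs k v))// ler_wpM2r// -(mulr1 mu^-1) ler_pdivlMl//.
      by rewrite (le_trans _ (sm_le1 k))// mulrC ler_wpM2l// ltW.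
    have zE : zeta k (u k.+1) =
        zeta k (ubar - v) + zeta k v + zeta k (u k.+1 - ubar).
      by rewrite -!(linz k).1 subrK addrC subrK.
    by rewrite (le_trans lo)// zE lerD// lerD.
  have cv1 : mu / m (psi l) @[l --> \oo] --> (1 : R).
    rewrite -[X in _ --> X](divff (lt0r_neq0 mu_gt0)).
    by apply: cvgM; [exact: cvg_cst|apply: cvgV; rewrite ?gt_eqF].
  have cv2 : NH (ubar - v) + mu^-1 * NJ v + NH (u (phi l) - ubar) @[l --> \oo] -->
      NH (ubar - v) + mu^-1 * NJ v.
    by rewrite -[X in _ --> X]addr0; apply: cvgD => //; exact: cvg_cst.
  have := ler_cvg_to cv1 cv2.
  by apply; near=> l.
have fbar : f ubar = 1 by apply/eqP; rewrite eq_le f1 andbT -Hbar.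
have df : dual N0 f.
  by apply: (lin_dominated_dual f CH0 1 nH lf) => // v; rewrite mul1r.
exists phi, ubar; split=> //; split.
  by move=> b0; move: Hbar; rewrite b0 (is_norm0 nH) => /esym/eqP; rewrite oner_eq0.
(* At the limit NH = 1 and NJ = mu, so H = 1 / p, J = mu ^ p / p and the Rayleigh quotient is mu ^
   p. *)
exists (mu `^ p), p^-1; split.
- by rewrite /pow_fun Hbar powR1 div1r.
- by apply/eqP; rewrite invr_eq0 gt_eqF.
- by rewrite /pow_fun Jbar.
exists (fun v => mu `^ p * f v); split; last first.
  exists f; split=> //; apply/(subdiff_pow _ _ _ _ _ nH p1); split=> // [|v].
    by rewrite fbar Hbar powR1.
  by rewrite Hbar powR1 mul1r.
have mf v : mu `^ p * f v <= mu `^ (p - 1) * NJ v.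
  rewrite -(mulr_powRB1 (ltW mu_gt0) p0) -mulrA mulrCA.
  by rewrite ler_pM2l ?powR_gt0// -ler_pdivlMl.
apply/(subdiff_pow _ _ _ _ _ nJ p1); rewrite Jbar; split=> //; last by rewrite fbar mulr1.
apply: (lin_dominated_dual _ CJ0 (mu `^ (p - 1)) nJ) => //; last exact: powR_ge0.
by split=> [x y|a x]; rewrite ?lf.1 ?lf.2 ?mulrDr// mulrCA.
Unshelve. all: by end_near. Qed.
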